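(* There is a $1$-periodic bounded function $G:\mathbb{R}\to\mathbb{R}$, continuous at every irrational number, such that $$\varphi_1(x)=-\tfrac12\mathcal{W}(x)+G(x)\quad\text{for almost every }x\in\mathbb{R}.$$
   Context: $\{t\}$ is the fractional part of $t$. $B_1(t)=\{t\}-\frac12$ if $t\notin\mathbb{Z}$ and $B_1(t)=0$ if $t\in\mathbb{Z}$. $\varphi_1(x)=\sum_{n\ge1}B_1(nx)/n$, a series converging almost everywhere and defining a $1$-periodic function. For $x\in X=(0,1)\setminus\mathbb{Q}$ put $\alpha(x)=\{1/x\}$, $\alpha_0(x)=x$, $\alpha_k(x)=\alpha(\alpha_{k-1}(x))$ for $k\ge1$, $\beta_{-1}=1$, $\beta_k(x)=\alpha_0(x)\cdots\alpha_k(x)$, $\gamma_k(x)=\beta_{k-1}(x)\log(1/\alpha_k(x))$. The Wilton function is $\mathcal{W}(x)=\sum_{k\ge0}(-1)^k\gamma_k(x)$, a series converging for almost every $x\in(0,1)$, extended to $\mathbb{R}$ by $\mathcal{W}(x)=\mathcal{W}(\{x\})$. *)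

(* Defs.v *)
From HB Require Import structures.
From mathcomp Require Import all_boot all_order all_algebra.
From mathcomp Require Import all_classical all_reals all_analysis.
Set Implicit Arguments.
Unset Strict Implicit.
Unset Printing Implicit Defensive.
Import Order.TTheory GRing.Theory Num.Theory.
Import numFieldNormedType.Exports.
Local Open Scope classical_set_scope.
Local Open Scope ring_scope.

Definition fracpart (R : realType) (t : R) : R := t - (Num.floor t)%:~R.

Definition B1 (R : realType) (t : R) : R :=
  if t \is a Num.int then 0 else fracpart t - 2^-1.

(* The index n of the sequence stands for the term of rank n + 1. *)
Definition phi1_term (R : realType) (x : R) : R^nat :=
  fun n => B1 (n.+1%:R * x) / n.+1%:R.

(* [limn] has an unspecified value where the series diverges. *)
Definition phi1 (R : realType) (x : R) : R := limn (series (phi1_term x)).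

Definition gauss (R : realType) (x : R) : R := fracpart x^-1.

Definition gauss_alpha (R : realType) (k : nat) (x : R) : R :=
  iter k (@gauss R) x.

(* Indices are shifted by one: [gauss_betap k] is beta_(k-1), so that
   [gauss_betap 0] is beta_(-1) = 1. *)
Definition gauss_betap (R : realType) (k : nat) (x : R) : R :=
  \prod_(i < k) gauss_alpha i x.

Definition gauss_gamma (R : realType) (k : nat) (x : R) : R :=
  gauss_betap k x * ln (gauss_alpha k x)^-1.

(* The series is meaningful for irrational x in (0, 1) and is evaluated at
   [fracpart x] to make it 1-periodic. At rational x, where some iterate of the
   Gauss map vanishes, its terms take conventional values (0^-1 = 0 and
   ln 0 = 0); these x form a null set. *)
Definition wilton_term (R : realType) (x : R) : R^nat :=
  fun k => (-1) ^+ k * gauss_gamma k (fracpart x).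

(* As for [phi1], the value is unspecified where the series diverges. *)
Definition wilton (R : realType) (x : R) : R := limn (series (wilton_term x)).

(* Main.v *)
Require Import Defs.
From HB Require Import structures.
From mathcomp Require Import all_boot all_order all_algebra.
From mathcomp Require Import all_classical all_reals all_analysis.
From mathcomp Require Import ring lra zify.
Set Implicit Arguments.
Unset Strict Implicit.
Unset Printing Implicit Defensive.
Import Order.TTheory GRing.Theory Num.Theory.
Import numFieldNormedType.Exports.
Local Open Scope classical_set_scope.
Local Open Scope ring_scope.

(** For [x] irrational in [(0, 1)] let [S(x, N)] be the partial sum of length [N]
    of the series [phi1 x], and let [M = floor (N x)]. Counting the lattice points
    below the line of slope [x] by columns and by rows ([lattice_count]) expresses
    [S(x, N) + x S(1/x, M)] by harmonic numbers and a factorial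
    ([phi1_reciprocity]). Their asymptotic expansions give
    [[
      S(x, N) + x S(1/x, M) = 1/2 ln x + F(x) + error,
    ]]
    where [F] ([recip_defect]) is bounded and continuous at the irrationals, being
    an affine function plus a uniformly convergent series. The error is [O(1/M)]
    if [M > 0], and [O(1 + ln (1/x))] if [M = 0 < N].

    Since [S(1/x, M) = S(alpha x, M)], this can be iterated along the Gauss orbit
    of [x], with lengths [N_0 = N] and [N_(k+1) = floor (N_k alpha_k)], until the
    length reaches [0]. One obtains
    [[
      S(x, N) = \sum_(k <= L) (-1)^k beta_(k-1) (1/2 ln alpha_k + F(alpha_k))
                + errors,
    ]]
    where [L] tends to infinity with [N]. Since [alpha_k alpha_(k+1) <= 1/2], the
    weights [beta_(k-1)] decay geometrically in [k], and the inverses of the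
    lengths decay geometrically when read backwards from [L]; so the errors add up
    to [O(L (3/4)^L + beta_(L-1) + gamma_L)] ([wilton_error]). This tends to [0]
    whenever Wilton's series converges at [x], and then
    [phi1 x = - 1/2 wilton x + G x] with
    [G x = \sum_k (-1)^k beta_(k-1) F(alpha_k)] ([phi1_wilton_pointwise]). The
    series [G] converges uniformly and its terms are continuous at the
    irrationals, so [G] is bounded and continuous there.

    Finally Wilton's series converges almost everywhere. The law of [alpha_k]
    under Lebesgue measure is dominated by twice the Gauss measure, which the
    Gauss map preserves ([gauss_preimage_measure]). By Borel-Cantelli,
    [alpha_k >= 2^-k] for [k] large, for almost every [x]; then [gamma_k] is at
    most [2 k (3/4)^k]. *)

(** * Harmonic numbers and factorials *)

(** The tails of [u] telescope against [d]: [u - d] increases, [u + d] decreases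
    and they are adjacent, so the limit lies between them at every rank. It gives
    an explicit rate of convergence for the constants and the series below. *)
Lemma dist_limn_telescope (R : realType) (u d : R^nat) :
  (forall n, `|u n - u n.+1| <= d n - d n.+1) -> d @ \oo --> 0 ->
  forall n, `|u n - limn u| <= d n.
Proof.
move=> ud d0 n.
have ndl : nondecreasing_seq (u \- d).
  by apply/nondecreasing_seqP => k /=; move: (ud k); rewrite ler_norml; lra.
have nir : nonincreasing_seq (u \+ d).
  by apply/nonincreasing_seqP => k /=; move: (ud k); rewrite ler_norml; lra.
have gap : (u \+ d) - (u \- d) @ \oo --> 0.
  have -> : (u \+ d) - (u \- d) = (fun k => d k + d k).
    by apply/funext => k; rewrite !fctE /=; ring.
  by rewrite -[X in _ --> X](addr0 0); exact: (cvgD d0 d0).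
have [lE cl cr] := adjacent_seq ndl nir gap.
have uE : limn u = limn (u \- d).
  apply: cvg_lim => //.
  have uE : (u \- d) + d = u by apply/funext => k; rewrite !fctE /= subrK.
  by have := cvgD cl d0; rewrite addr0 uE; apply.
have := nondecreasing_cvgn_le ndl cl n; have := nonincreasing_cvgn_ge nir cr n.
by rewrite ler_norml lE -uE /=; lra.
Qed.

Lemma is_derive_ge0_ndecr1 (R : realType) (f df : R -> R) :
  (forall x : R, 1 <= x -> is_derive x 1 f (df x)) ->
  (forall x : R, 1 <= x -> 0 <= df x) -> forall y : R, 1 <= y -> f 1 <= f y.
Proof.
move=> fdf df0 y y1; apply: (@ger0_derive1_ndecry _ f 1) => //.
- by move=> x; rewrite in_itv/= andbT => /ltW /fdf [].
- move=> x; rewrite in_itv/= andbT => /ltW x1; have fx := fdf x x1.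
  by rewrite derive1E derive_val; exact: df0.
- apply: derivable_within_continuous => x; rewrite in_itv/= andbT => /fdf.
  by case.
Qed.

(** The difference vanishes at [1] and has derivative [(1 - 1/y)^2 / 2]. Used at
    [y = (a + 1) / a], where it is the trapezoidal estimate of the integral of
    [1/t] over [[a, a + 1]]. *)
Lemma ln_le_trapezoid (R : realType) (y : R) : 1 <= y -> ln y <= (y - y^-1) / 2.
Proof.
move=> y1; rewrite -subr_ge0.
pose f (x : R) := (x - x^-1) / 2 - ln x.
have -> : 0 = f 1 by rewrite /f ln1 invr1; lra.
apply: (@is_derive_ge0_ndecr1 _ f (fun x => (1 + x ^- 2) / 2 - x^-1)) => //.
- move=> x x1; have x0 : 0 < x by lra.
  have dV : is_derive x 1 (fun t : R => t^-1) (- x ^- 2 *: 1).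
    by apply: is_deriveV; rewrite gt_eqF.
  have dln := is_derive1_ln x0.
  by apply: is_derive_eq; rewrite /GRing.scale /=; field; rewrite gt_eqF.
- move=> x x1.
  have -> : (1 + x ^- 2) / 2 - x^-1 = (1 - x^-1) ^+ 2 / 2.
    by field; rewrite gt_eqF//; lra.
  by rewrite divr_ge0 ?sqr_ge0.
Qed.

(** The difference vanishes at [1] and has derivative
    [(y - 1)^2 / (y (y + 1)^2)]. At [y = (a + 1) / a] it is the midpoint estimate
    of the same integral. *)
Lemma ln_ge_midpoint (R : realType) (y : R) :
  1 <= y -> 2 * (y - 1) / (y + 1) <= ln y.
Proof.
move=> y1; rewrite -subr_ge0.
pose f (x : R) := ln x - 2 * (x - 1) * (x + 1)^-1.
have -> : 0 = f 1 by rewrite /f ln1; lra.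
apply: (@is_derive_ge0_ndecr1 _ f (fun x => x^-1 - 4 / (x + 1) ^+ 2)) => //.
- move=> x x1; have x0 : 0 < x by lra.
  have dV : is_derive x 1 (fun t : R => (t + 1)^-1) (- (x + 1) ^- 2 *: (1 + 0)).
    by apply: is_deriveV; rewrite gt_eqF//; lra.
  have dln := is_derive1_ln x0.
  by apply: is_derive_eq; rewrite /GRing.scale /=; field; rewrite !gt_eqF//; lra.
- move=> x x1.
  have -> : x^-1 - 4 / (x + 1) ^+ 2 = (x - 1) ^+ 2 / (x * (x + 1) ^+ 2).
    by field; rewrite !gt_eqF//; lra.
  by rewrite divr_ge0 ?sqr_ge0// mulr_ge0 ?sqr_ge0//; lra.
Qed.

Lemma ln_succ_sub_bounds (R : realType) (a : R) : 0 < a ->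
  2 / (2 * a + 1) <= ln (a + 1) - ln a <= (a^-1 + (a + 1)^-1) / 2.
Proof.
move=> a0; have a10 : 0 < a + 1 by lra.
have y1 : 1 <= (a + 1) / a by rewrite ler_pdivlMr//; lra.
have := ln_ge_midpoint y1; have := ln_le_trapezoid y1.
rewrite ln_div ?posrE//.
have -> : ((a + 1) / a - ((a + 1) / a)^-1) / 2 = (a^-1 + (a + 1)^-1) / 2.
  by field; rewrite !gt_eqF.
have -> : 2 * ((a + 1) / a - 1) / ((a + 1) / a + 1) = 2 / (2 * a + 1).
  by field; rewrite !gt_eqF//; lra.
by move=> -> ->.
Qed.

Definition euler_gamma (R : realType) : R :=
  limn (fun n => series harmonic n.+1 - ln n.+1%:R - (2 * n.+1%:R)^-1).

Definition stirling_const (R : realType) : R :=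
  limn (fun n => ln (n.+1)`!%:R - (n.+1%:R + 2^-1) * ln n.+1%:R + n.+1%:R).

(** The increment of the left-hand side is the error of the trapezoidal rule for
    [1/t] on a unit interval, which the midpoint rule bounds by a telescoping
    term. An error of order [1/n] would not do, since the errors at the points
    [m / x] are summed over [m] in the reciprocity law. *)
Lemma harmonic_asymp (R : realType) (n : nat) : (0 < n)%N ->
  `|series harmonic n - ln n%:R - (2 * n%:R)^-1 - euler_gamma R|
    <= (n%:R ^+ 2)^-1.
Proof.
case: n => // n _.
pose d (k : nat) : R := (k.+1%:R ^+ 2)^-1.
pose u (k : nat) : R := series harmonic k.+1 - ln k.+1%:R - (2 * k.+1%:R)^-1.
apply: (@dist_limn_telescope R u d) => [k|]; last first.
  have -> : d = fun k => harmonic k ^+ 2 by apply/funext => k; rewrite /d /= exprVn.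
  by have := cvgM (@cvg_harmonic R) (@cvg_harmonic R); rewrite mulr0; apply.
have -> : u k.+1 = series harmonic k.+1 + k.+2%:R^-1 - ln k.+2%:R - (2 * k.+2%:R)^-1.
  by rewrite /u /series /= [in LHS]big_nat_recr.
rewrite /u /d.
set s := series _ _; set a : R := k.+1%:R.
have a0 : 0 < a by rewrite ltr0n.
have -> : k.+2%:R = a + 1 by rewrite -natr1.
have /andP[lo hi] := ln_succ_sub_bounds a0.
have -> : (s - ln a - (2 * a)^-1) - (s + (a + 1)^-1 - ln (a + 1) - (2 * (a + 1))^-1)
  = (ln (a + 1) - ln a) - (a^-1 + (a + 1)^-1) / 2 by field; rewrite !gt_eqF//; lra.
rewrite ler0_norm ?subr_le0// opprB.
apply: (le_trans (lerB (lexx _) lo)); rewrite -subr_ge0.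
have -> : (a ^+ 2)^-1 - ((a + 1) ^+ 2)^-1 - ((a^-1 + (a + 1)^-1) / 2 - 2 / (2 * a + 1))
   = (7 * a ^+ 2 + 7 * a + 2) / (2 * a ^+ 2 * (a + 1) ^+ 2 * (2 * a + 1)).
  by field; rewrite !gt_eqF//; lra.
by rewrite divr_ge0 ?mulr_ge0 ?addr_ge0 ?mulr_ge0 ?sqr_ge0//; lra.
Qed.

(** By the midpoint and trapezoidal bounds, [(n + 1/2) ln ((n + 1) / n) - 1] is
    between [0] and [1 / (4 n (n + 1))], which
    telescopes. *)
Lemma stirling (R : realType) (n : nat) : (0 < n)%N ->
  `|ln n`!%:R - (n%:R + 2^-1) * ln n%:R + n%:R - stirling_const R| <= n%:R^-1.
Proof.
case: n => // n _.
pose u (k : nat) : R := ln (k.+1)`!%:R - (k.+1%:R + 2^-1) * ln k.+1%:R + k.+1%:R.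
apply: (@dist_limn_telescope R u harmonic) => [k|]; last exact: cvg_harmonic.
rewrite /u /= [k.+2`!]factS natrM lnM ?posrE ?ltr0n ?fact_gt0//.
set s := ln _; set a : R := k.+1%:R.
have a0 : 0 < a by rewrite ltr0n.
have -> : k.+2%:R = a + 1 by rewrite -natr1.
have /andP[lo hi] := ln_succ_sub_bounds a0.
have -> : s - (a + 2^-1) * ln a + a -
  (ln (a + 1) + s - (a + 1 + 2^-1) * ln (a + 1) + (a + 1)) =
  (a + 2^-1) * (ln (a + 1) - ln a - 2 / (2 * a + 1)).
  by field; lra.
rewrite ger0_norm; last by rewrite mulr_ge0//; lra.
apply: (@le_trans _ _ ((a + 2^-1) * ((a^-1 + (a + 1)^-1) / 2 - 2 / (2 * a + 1)))).
  by rewrite ler_pM2l ?lerD2r//; lra.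
rewrite -subr_ge0.
have -> : a^-1 - (a + 1)^-1 - (a + 2^-1) * ((a^-1 + (a + 1)^-1) / 2 - 2 / (2 * a + 1))
   = 3 / (4 * a * (a + 1)).
  by field; rewrite !gt_eqF//; lra.
by rewrite divr_ge0 ?mulr_ge0//; lra.
Qed.

(** * Fractional parts and irrational numbers *)

(** Irrationality is transported backwards along any map that sends rationals to
    rationals. *)
Lemma irrational_comp_rat (R : realType) (x y : R) (f : rat -> rat) :
  irrational x -> (forall q : rat, y = ratr q -> x = ratr (f q)) -> irrational y.
Proof. by move=> ix h [q _ yq]; apply: ix; exists (f q) => //; rewrite -(h q). Qed.

Lemma irrational_neq0 (R : realType) (x : R) : irrational x -> x != 0.
Proof. by move=> ix; apply/eqP => x0; apply: ix; exists 0; rewrite ?rmorph0. Qed.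

Lemma irrational_nint (R : realType) (x : R) : irrational x -> x \isn't a Num.int.
Proof.
move=> ix; apply/negP => /floorK xE; apply: ix.
by exists (Num.floor x)%:~R; rewrite ?ratr_int.
Qed.

Lemma irrational_inv (R : realType) (x : R) : irrational x -> irrational x^-1.
Proof.
move=> ix; apply: (irrational_comp_rat (f := fun q => q^-1) ix) => q xq.
by rewrite fmorphV /= -xq invrK.
Qed.

Lemma irrational_mulSn (R : realType) (x : R) (n : nat) :
  irrational x -> irrational (n.+1%:R * x).
Proof.
move=> ix; apply: (irrational_comp_rat (f := fun q => q / n.+1%:R) ix) => q xq.
by rewrite fmorph_div/= ratr_nat -xq mulrC mulKf// pnatr_eq0.
Qed.

Lemma irrational_fracpart (R : realType) (x : R) :
  irrational x -> irrational (fracpart x).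
Proof.
move=> ix.
apply: (irrational_comp_rat (f := fun q => q + (Num.floor x)%:~R) ix) => q xq.
by rewrite rmorphD /= ratr_int -xq subrK.
Qed.

Lemma fracpart_ge0 (R : realType) (x : R) : 0 <= fracpart x.
Proof. by rewrite subr_ge0 floor_le. Qed.

Lemma fracpart_lt1 (R : realType) (x : R) : fracpart x < 1.
Proof. by rewrite ltrBlDl; have := floorD1_gt x; rewrite intrD. Qed.

Lemma fracpart_truncn (R : realType) (x : R) :
  0 <= x -> fracpart x = x - (Num.truncn x)%:R.
Proof.
move=> x0; rewrite /fracpart truncn_floor x0; congr (_ - _).
by rewrite -[in LHS](gez0_abs (_ : 0 <= Num.floor x)) ?floor_ge0.
Qed.

Lemma fracpartD_int (R : realType) (x z : R) :
  z \is a Num.int -> fracpart (x + z) = fracpart x.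
Proof. by move=> zi; rewrite /fracpart floorDrz// intrD (floorK zi); ring. Qed.

Lemma fracpart_id (R : realType) (x : R) : 0 <= x < 1 -> fracpart x = x.
Proof.
move=> x01; rewrite /fracpart (_ : Num.floor x = 0) ?subr0//.
by apply: floor_def; rewrite add0r.
Qed.

Lemma irrational_fracpart_gt0 (R : realType) (x : R) :
  irrational x -> 0 < fracpart x.
Proof.
move=> ix; rewrite lt_def fracpart_ge0 andbT.
exact/irrational_neq0/irrational_fracpart.
Qed.

Lemma B1_irrational (R : realType) (x : R) :
  irrational x -> B1 x = fracpart x - 2^-1.
Proof. by move=> ix; rewrite /B1 (negbTE (irrational_nint ix)). Qed.

Lemma B1D_int (R : realType) (x z : R) : z \is a Num.int -> B1 (x + z) = B1 x.
Proof.
move=> zi; rewrite /B1 fracpartD_int//.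
suff -> : (x + z \is a Num.int) = (x \is a Num.int) by [].
by apply/idP/idP => [h|h]; [rewrite -(addrK z x) rpredB|rewrite rpredD].
Qed.

(** Periodicity of the series, term by term; at [1/x] it turns [1/x] into the
    Gauss map. *)
Lemma phi1_term_fracpart (R : realType) (x : R) :
  phi1_term (fracpart x) = phi1_term x.
Proof.
apply/funext => n; rewrite /phi1_term; congr (_ / _).
rewrite -(B1D_int _ (z := n.+1%:R * (Num.floor x)%:~R)) ?rpredM ?natr_int ?intr_int//.
by congr B1; rewrite /fracpart; ring.
Qed.

(** * The reciprocity law *)

(** Remainder of the Euler-Maclaurin expansion of the harmonic sum up to a real
    number [y]. The value [0] for [y < 1] keeps it bounded near [0]. *)
Definition harmonic_defect (R : realType) (y : R) : R :=
  if y < 1 then 0 else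
  series harmonic (Num.truncn y) - ln y - euler_gamma R + (fracpart y - 2^-1) / y.

Lemma ln_sub_bounds (R : realType) (a b : R) : 0 < a -> 0 < b ->
  (b - a) / b <= ln b - ln a <= (b - a) / a.
Proof.
suff h (u v : R) : 0 < u -> 0 < v -> ln v - ln u <= (v - u) / u.
  move=> a0 b0; rewrite h// andbT; have := h _ _ b0 a0.
  by rewrite -(opprB a b) mulNr; lra.
move=> u0 v0; rewrite -ln_div ?posrE//.
have -> : v / u = 1 + (v - u) / u by field; rewrite gt_eqF.
by apply: le_ln1Dx; rewrite ltr_pdivlMr//; lra.
Qed.

(** For [n <= y < n + 1] the term [({y} - 1/2) / y] compensates both
    [ln y - ln n] and [1 / (2 n)] up to [1 / (2 n y)]. *)
Lemma harmonic_defect_le (R : realType) (y : R) :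
  1 <= y -> `|harmonic_defect y| <= 5 / y ^+ 2.
Proof.
move=> y1; rewrite /harmonic_defect ltNge y1 /=.
have y0 : 0 < y by lra.
rewrite fracpart_truncn; last lra.
have n0 : (0 < Num.truncn y)%N by rewrite truncn_gt0.
have /andP[ny yn] := truncn_itv (ltW y0).
have := harmonic_asymp R n0.
move: (Num.truncn y) n0 ny yn => n n0; rewrite -natr1.
set h := series _ _; have a1 : 1 <= n%:R :> R by rewrite ler1n.
move: (n%:R : R) a1 => a a1 ay ya hh.
have a0 : 0 < a by lra.
have /andP[lo hi] := ln_sub_bounds a0 y0.
pose br := (2 * a)^-1 - (ln y - ln a) + (y - a - 2^-1) / y.
have brle : `|br| <= (2 * (a * y))^-1.
  rewrite ler_norml; apply/andP; split.
    apply: (@le_trans _ _ ((2 * a)^-1 - (y - a) / a + (y - a - 2^-1) / y)); last first.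
      by rewrite lerD2r lerB.
    rewrite -subr_ge0.
    have -> : (2 * a)^-1 - (y - a) / a + (y - a - 2^-1) / y - - (2 * (a * y))^-1 =
      (1 - (y - a)) * (1 + 2 * (y - a)) / (2 * (a * y)).
      by field; rewrite !gt_eqF.
    by rewrite divr_ge0 ?mulr_ge0//; lra.
  apply: (@le_trans _ _ ((2 * a)^-1 - (y - a) / y + (y - a - 2^-1) / y)).
    by rewrite lerD2r lerB.
  rewrite -subr_ge0.
  have -> : (2 * (a * y))^-1 - ((2 * a)^-1 - (y - a) / y + (y - a - 2^-1) / y) =
     (1 - (y - a)) / (2 * (a * y)).
    by field; rewrite !gt_eqF.
  by rewrite divr_ge0 ?mulr_ge0//; lra.
have -> : h - ln y - euler_gamma R + (y - a - 2^-1) / y =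
  (h - ln a - (2 * a)^-1 - euler_gamma R) + br by rewrite /br; ring.
apply: (le_trans (ler_normD _ _)); apply: (le_trans (lerD hh brle)).
rewrite -subr_ge0.
have -> : 5 / y ^+ 2 - ((a ^+ 2)^-1 + (2 * (a * y))^-1) =
  (2 * ((2 * a - y) * (2 * a + y)) + a * (2 * a - y))
   / (2 * (a ^+ 2 * y ^+ 2)).
  by field; rewrite !gt_eqF.
have h2 : 0 <= 2 * a - y by lra.
by rewrite divr_ge0 ?addr_ge0 ?mulr_ge0 ?sqr_ge0//; lra.
Qed.

Lemma sum_nat_lt (R : realType) (M k : nat) : (k <= M)%N ->
  \sum_(m < M) (m < k)%N%:R = k%:R :> R.
Proof.
elim: M => [|M IH]; first by rewrite leqn0 big_ord0 => /eqP ->.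
rewrite leq_eqVlt => /predU1P[->|kM].
  by under eq_bigr => i _ do rewrite ltn_ord; rewrite sumr_const card_ord.
by rewrite big_ord_recr /= IH// ltnNge -ltnS kM addr0.
Qed.

Lemma harmonic_tail (R : realType) (t N : nat) : (t <= N)%N ->
  \sum_(n < N) (t <= n)%N%:R / n.+1%:R
    = series harmonic N - series harmonic t :> R.
Proof.
move=> tN; rewrite sub_series tN -(big_mkord xpredT (fun n => (t <= n)%N%:R / n.+1%:R)).
rewrite (big_cat_nat (leq0n t) tN)//= big_nat big1 ?add0r; last first.
  by move=> i /andP[_ it]; rewrite leqNgt it mul0r.
by apply: eq_big_nat => i /andP[-> _]; rewrite mul1r.
Qed.

(** Both sides add [1/n] over the lattice points [(m, n)] with [n <= N] and
    [0 < m <= n x], by columns on the left and by rows on the right. As [x] is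
    irrational no lattice point lies on the line, so that [m <= n x] can be
    replaced by [m / x < n]. *)
Lemma lattice_count (R : realType) (x : R) (N : nat) : irrational x -> 0 < x ->
  \sum_(n < N) (Num.truncn (n.+1%:R * x))%:R / n.+1%:R =
  \sum_(m < Num.truncn (N%:R * x))
     (series harmonic N - series harmonic (Num.truncn (m.+1%:R / x))) :> R.
Proof.
move=> ix x0; set M := Num.truncn (N%:R * x).
have nx0 (n : nat) : 0 <= n%:R * x by rewrite mulr_ge0 ?ler0n// ltW.
transitivity (\sum_(n < N) \sum_(m < M)
    ((Num.truncn (m.+1%:R / x) <= n)%N%:R / n.+1%:R) : R).
  apply: eq_bigr => n _; rewrite -mulr_suml; congr (_ / _).
  rewrite -(@sum_nat_lt R M (Num.truncn _)); last first.
    by apply: le_truncn; rewrite ler_pM2r// ler_nat.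
  apply: eq_bigr => m _; congr ((nat_of_bool _)%:R).
  rewrite truncn_gt_nat truncn_le_nat ltr_pdivrMr// le_eqVlt.
  case: eqP => // mn; have := irrational_nint (irrational_mulSn (n := n) ix).
  by rewrite -mn natr_int.
rewrite exchange_big /=; apply: eq_bigr => m _; rewrite harmonic_tail//.
rewrite truncn_le_nat ltr_pdivrMr//.
apply: (@le_lt_trans _ _ (N%:R * x)); last by rewrite ltr_pM2r// ltr_nat.
by apply: le_trans (_ : M%:R <= _); rewrite ?ler_nat// truncn_le.
Qed.

Lemma ln_fact (R : realType) (M : nat) :
  ln M`!%:R = \sum_(m < M) ln m.+1%:R :> R.
Proof.
elim: M => [|M IH]; first by rewrite big_ord0 fact0 ln1.
by rewrite factS natrM lnM ?posrE ?ltr0n ?fact_gt0// big_ord_recr/= IH addrC.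
Qed.

(** Insert [B1 t = t - floor t - 1/2] in the partial sum. The count by rows
    brings in the harmonic numbers at [m / x], whose expansion contains
    [B1 (m / x)]: this is the partial sum of the series at [1 / x]. *)
Lemma phi1_reciprocity (R : realType) (x : R) (N : nat) :
  irrational x -> 0 < x < 1 ->
  let M := Num.truncn (N%:R * x) in
  series (phi1_term x) N + x * series (phi1_term x^-1) M =
    N%:R * x - series harmonic N / 2 - M%:R * series harmonic N
    + ln M`!%:R - M%:R * ln x + M%:R * euler_gamma R
    + \sum_(m < M) harmonic_defect (m.+1%:R / x).
Proof.
move=> ix /andP[x0 x1] M.
have S1 : series (phi1_term x) N = N%:R * x - series harmonic N / 2
    - \sum_(n < N) (Num.truncn (n.+1%:R * x))%:R / n.+1%:R.
  rewrite /series /= !big_mkord.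
  have -> : N%:R * x = \sum_(n < N) x by rewrite sumr_const card_ord mulr_natl.
  rewrite mulr_suml -!sumrB; apply: eq_bigr => n _.
  rewrite /phi1_term B1_irrational; last exact: irrational_mulSn.
  rewrite fracpart_truncn; last by rewrite mulr_ge0// ltW.
  by rewrite /=; field; rewrite nat1r pnatr_eq0.
have S2 : x * series (phi1_term x^-1) M = \sum_(m < M)
   (harmonic_defect (m.+1%:R / x) - series harmonic (Num.truncn (m.+1%:R / x))
    + (ln m.+1%:R - ln x) + euler_gamma R).
  have -> : series (phi1_term x^-1) M = \sum_(m < M) phi1_term x^-1 m.
    by rewrite /series /= big_mkord.
  rewrite mulr_sumr; apply: eq_bigr => m _.
  have y1 : 1 <= m.+1%:R / x.
    rewrite ler_pdivlMr// mul1r (le_trans (ltW x1))// ler1n//.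
  rewrite /harmonic_defect ltNge y1 /= -ln_div ?posrE//.
  rewrite /phi1_term B1_irrational; last exact/irrational_mulSn/irrational_inv.
  by field; rewrite nat1r pnatr_eq0 gt_eqF.
rewrite S1 lattice_count// S2 -/M ln_fact.
have sumc (a : R) : \sum_(m < M) a = M%:R * a.
  by rewrite sumr_const card_ord mulr_natl.
rewrite !big_split/= !sumrN !sumc; ring.
Qed.

Lemma phi1_term_gauss (R : realType) (x : R) :
  phi1_term x^-1 = phi1_term (gauss x).
Proof. by rewrite /gauss phi1_term_fracpart. Qed.

(** Cutting off outside [0 < x < 1] makes the bound below uniform in [x]. *)
Definition defect_term (R : realType) (x : R) : R^nat :=
  fun m => if 0 < x < 1 then harmonic_defect (m.+1%:R / x) else 0.

Definition defect_series (R : realType) (x : R) : R :=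
  limn (series (defect_term x)).

(** The term of rank [m] is at most [5 x^2 / m^2 <= 10 / m - 10 / (m + 1)]. *)
Lemma dist_defect_series (R : realType) (x : R) (n : nat) :
  `|series (defect_term x) n - defect_series x| <= 10 / n.+1%:R.
Proof.
apply: (@dist_limn_telescope R _ (fun k => 10 / k.+1%:R)) => [k|]; last first.
  by have := cvgM (cvg_cst (10 : R)) (@cvg_harmonic R); rewrite mulr0; apply.
rewrite distrC seriesSB -(natr1 k.+1).
have : 1 <= k.+1%:R :> R by rewrite ler1n.
set a : R := k.+1%:R => a1.
have d0 : 0 <= 10 / a - 10 / (a + 1).
  by rewrite subr_ge0 ler_pM2l// lef_pV2 ?posrE; lra.
rewrite /defect_term; case: ifP => [/andP[x0 x1]|]; last by rewrite normr0.
rewrite -/a; apply: le_trans (harmonic_defect_le _) _.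
  by rewrite ler_pdivlMr//; lra.
have -> : 5 / (a / x) ^+ 2 = x ^+ 2 * (5 / a ^+ 2) by field; rewrite !gt_eqF//; lra.
apply: (@le_trans _ _ (5 / a ^+ 2)).
  by rewrite ger_pMl ?expr_le1 ?divr_gt0 ?exprn_gt0//; lra.
rewrite -subr_ge0.
have -> : 10 / a - 10 / (a + 1) - 5 / a ^+ 2 = 5 * (a - 1) / (a ^+ 2 * (a + 1)).
  by field; rewrite !gt_eqF//; lra.
by rewrite divr_ge0 ?mulr_ge0 ?sqr_ge0//; lra.
Qed.

Lemma defect_series_le (R : realType) (x : R) : `|defect_series x| <= 10.
Proof.
by have := dist_defect_series x 0; rewrite /series /= big_geq// sub0r normrN divr1.
Qed.

(** The function [F] of the approximate functional equation
    [phi1 x + x * phi1 (1 / x) = 1/2 * ln x + F x]. *)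
Definition recip_defect (R : realType) (x : R) : R :=
  stirling_const R - euler_gamma R / 2 - x / 2 + defect_series x.

Definition recip_bound (R : realType) : R :=
  `|stirling_const R| + `|euler_gamma R| + 15.

Lemma recip_defect_le (R : realType) (x : R) :
  0 <= x <= 1 -> `|recip_defect x| <= recip_bound R.
Proof.
move=> x01; have := defect_series_le x.
rewrite /recip_defect /recip_bound.
move: (defect_series x) (stirling_const R) (euler_gamma R) => d s g.
rewrite !ler_norml.
have := ler_norm s; have := ler_norm g; have := ler_norm (- s); have := ler_norm (- g).
rewrite !normrN; lra.
Qed.

Definition recip_error (R : realType) (x : R) (N : nat) : R :=
  series (phi1_term x) N
  + x * series (phi1_term x^-1) (Num.truncn (N%:R * x))
  - (2^-1 * ln x + recip_defect x).

(** Put [a = M], [b = N] and [b x = a + theta]. The large terms combine into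
    [theta - (a + 1/2) ln (1 + theta / a)], which is of order [1 / a] since
    [theta / (a + theta) <= ln (1 + theta / a) <= theta / a]; the others are the
    remainders of the harmonic number, of Stirling's formula and of
    [defect_series]. *)
Lemma recip_error_pos (R : realType) (x : R) (N : nat) :
  irrational x -> 0 < x < 1 -> (0 < Num.truncn (N%:R * x))%N ->
  `|recip_error x N| <= 15 / (Num.truncn (N%:R * x))%:R.
Proof.
move=> ix x01; set M := Num.truncn _ => M0; have /andP[x0 x1] := x01.
have N0 : (0 < N)%N.
  by move: M0; rewrite /M; case: (N) => //; rewrite mul0r truncn0.
have p0 : 0 <= N%:R * x by rewrite mulr_ge0// ltW.
have /andP[] := truncn_itv p0; rewrite -/M -natr1.
rewrite /recip_error phi1_reciprocity// -/M.
have -> : \sum_(m < M) harmonic_defect (m.+1%:R / x) = series (defect_term x) M.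
  by rewrite /series /= big_mkord /defect_term x01.
have := harmonic_asymp R N0; have := stirling R M0.
have := dist_defect_series x M; rewrite -(natr1 M) /recip_defect.
have : 1 <= M%:R :> R by rewrite ler1n.
have : 0 < N%:R :> R by rewrite ltr0n.
move: (series harmonic N) (ln M`!%:R) (series _ M) (defect_series x).
move: (M%:R : R) (N%:R : R).
move: (stirling_const R) (euler_gamma R) => s g a b h l d ds b0 a1.
have a0 : 0 < a by lra.
set e := d - ds => he; set st := _ - s => hst; set r := _ - g => hr ap pa.
have pp : 0 < b * x by rewrite mulr_gt0.
have ab : a <= b by apply: le_trans ap _; rewrite ger_pMr// ltW.
have /andP[lo hi] := ln_sub_bounds a0 pp.
have lnp : ln (b * x) = ln b + ln x by rewrite lnM.
(* [A1] collects the logarithms, [A2] the terms in [1 / N]. *)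
pose A1 := b * x - a - (a + 2^-1) * (ln (b * x) - ln a).
pose A2 := (b * x - a - 2^-1) / (2 * b).
have -> : b * x - h / 2 - a * h + l - a * ln x + a * g + d -
   (2^-1 * ln x + (s - g / 2 - x / 2 + ds)) = A1 + A2 - (a + 2^-1) * r + st + e.
  by rewrite /A1 /A2 /r /st /e lnp; field; rewrite gt_eqF.
have hA1 : `|A1| <= 1 / a.
  have a20 : 0 < a + 2^-1 by lra.
  rewrite ler_norml; apply/andP; split.
    apply: (@le_trans _ _ (b * x - a - (a + 2^-1) * ((b * x - a) / a))); last first.
      by rewrite lerD2l lerN2 ler_pM2l.
    rewrite -subr_ge0.
    have -> : b * x - a - (a + 2^-1) * ((b * x - a) / a) - - (1 / a) =
      (2 - (b * x - a)) / (2 * a) by field; rewrite gt_eqF.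
    by rewrite divr_ge0//; lra.
  apply: (@le_trans _ _ (b * x - a - (a + 2^-1) * ((b * x - a) / (b * x)))).
    by rewrite lerD2l lerN2 ler_pM2l.
  have pV : (b * x)^-1 <= a^-1 by rewrite lef_pV2.
  apply: (@le_trans _ _ (1 / (b * x))); last by rewrite !div1r.
  rewrite -subr_ge0.
  have -> : 1 / (b * x) - (b * x - a - (a + 2^-1) * ((b * x - a) / (b * x))) =
     (1 - (b * x - a) * (b * x - a - 2^-1)) / (b * x).
    by field; rewrite !gt_eqF.
  by rewrite divr_ge0 ?(ltW pp)//; nra.
have bV : b^-1 <= a^-1 by rewrite lef_pV2.
have hA2 : `|A2| <= 1 / a.
  have -> : A2 = ((b * x - a - 2^-1) / 2) * b^-1 by rewrite /A2; field; rewrite gt_eqF.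
  have bV0 : 0 <= b^-1 by rewrite invr_ge0 ltW.
  rewrite normrM (ger0_norm bV0); apply: ler_pM => //.
  by rewrite ler_norml; lra.
have hA3 : `|(a + 2^-1) * r| <= 2 / a.
  rewrite normrM (ger0_norm (_ : 0 <= a + 2^-1)); last lra.
  apply: (@le_trans _ _ ((2 * a) * (a ^+ 2)^-1)).
    apply: ler_pM => //; [lra|lra|]; apply: (le_trans hr).
    by rewrite lef_pV2 ?posrE ?exprn_gt0// ler_sqr ?nnegrE// ltW.
  by rewrite le_eqVlt; apply/orP; left; apply/eqP; field; rewrite gt_eqF.
have he' : `|e| <= 10 / a.
  by apply: (le_trans he); rewrite ler_pM2l// lef_pV2 ?posrE; lra.
have -> : 15 / a = 1 / a + 1 / a + 2 / a + a^-1 + 10 / a by field; rewrite gt_eqF.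
apply: le_trans (ler_normD _ _) _; apply: lerD => //.
apply: le_trans (ler_normD _ _) _; apply: lerD => //.
apply: le_trans (ler_normB _ _) _; apply: lerD => //.
by apply: le_trans (ler_normD _ _) _; apply: lerD.
Qed.

(** When the sum at [1 / x] is empty the remaining partial sum at [x] is about
    [- 1/2 ln N], and [1 <= N < 1 / x]. The logarithm cannot be avoided, but an
    orbit meets this case only once. *)
Lemma recip_error_last (R : realType) (x : R) (N : nat) :
  irrational x -> 0 < x < 1 -> (0 < N)%N -> Num.truncn (N%:R * x) = 0%N ->
  `|recip_error x N| <= recip_bound R + 2^-1 * ln x^-1.
Proof.
move=> ix x01 N0; set M := Num.truncn _ => M0; have /andP[x0 x1] := x01.
have p0 : 0 <= N%:R * x by rewrite mulr_ge0// ltW.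
have /andP[_] := truncn_itv p0; rewrite -/M.
rewrite /recip_error phi1_reciprocity// -/M M0 big_ord0 fact0 ln1 !mul0r lnV//.
have := defect_series_le x.
have := harmonic_asymp R N0; rewrite /recip_defect /recip_bound.
have : 1 <= N%:R :> R by rewrite ler1n.
move: (series harmonic N) (defect_series x) (N%:R : R).
move: (stirling_const R) (euler_gamma R) => s g h d b b1.
have b0 : 0 < b by lra.
have lnp : ln (b * x) = ln b + ln x by rewrite lnM.
have lb : 0 <= ln b by apply: ln_ge0.
have bV : b^-1 <= 1 by rewrite invf_le1.
have bV0 : 0 <= b^-1 by rewrite invr_ge0 ltW.
have b2V : (b ^+ 2)^-1 <= 1 by rewrite invf_le1 ?exprn_gt0// exprn_ege1.
rewrite invfM => hr hd p1.
have lp : ln b + ln x <= 0 by rewrite -lnp ln_le0// ltW.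
have : 0 < b * x by rewrite mulr_gt0.
move: hr hd; rewrite !ler_norml.
have := ler_norm s; have := ler_norm g; have := ler_norm (- s); have := ler_norm (- g).
rewrite !normrN; lra.
Qed.

(** * Iteration along the Gauss orbit *)

Lemma gauss_alphaS (R : realType) (k : nat) (x : R) :
  gauss_alpha k.+1 x = gauss (gauss_alpha k x).
Proof. by []. Qed.

Lemma gauss_betapS (R : realType) (k : nat) (x : R) :
  gauss_betap k.+1 x = gauss_betap k x * gauss_alpha k x.
Proof. by rewrite /gauss_betap big_ord_recr. Qed.

Lemma gauss_alpha_itv (R : realType) (k : nat) (x : R) :
  0 <= x < 1 -> 0 <= gauss_alpha k x < 1.
Proof.
by case: k => // k _; rewrite gauss_alphaS /gauss fracpart_ge0 fracpart_lt1.
Qed.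

Lemma gauss_alpha_irrational (R : realType) (k : nat) (x : R) :
  irrational x -> irrational (gauss_alpha k x).
Proof.
move=> ix; elim: k => // k IH.
exact/irrational_fracpart/irrational_inv.
Qed.

Lemma gauss_alpha_gt0 (R : realType) (k : nat) (x : R) :
  irrational x -> 0 <= x < 1 -> 0 < gauss_alpha k x.
Proof.
move=> ix x01; have /andP[a0 _] := gauss_alpha_itv k x01.
by rewrite lt_def a0 andbT; exact/irrational_neq0/gauss_alpha_irrational.
Qed.

Lemma gauss_betap_ge0 (R : realType) (k : nat) (x : R) :
  0 <= x < 1 -> 0 <= gauss_betap k x.
Proof.
by move=> x01; apply: prodr_ge0 => i _; have /andP[] := gauss_alpha_itv i x01.
Qed.

(** If [x <= 1/2] use [gauss x < 1]; otherwise [gauss x = 1 / x - 1]. *)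
Lemma mul_gauss_le_half (R : realType) (x : R) :
  0 <= x < 1 -> x * gauss x <= 2^-1.
Proof.
move=> /andP[x0 x1]; have g0 := fracpart_ge0 x^-1; have g1 := fracpart_lt1 x^-1.
have [xh|xh] := leP x 2^-1; first by rewrite /gauss; nra.
have V1 : 1 <= x^-1 by rewrite invf_ge1; lra.
rewrite /gauss fracpart_truncn; last lra.
have n1 : 1 <= (Num.truncn x^-1)%:R :> R by rewrite ler1n truncn_gt0.
rewrite mulrBr divff; last by rewrite gt_eqF//; lra.
by nra.
Qed.

(** Two successive factors multiply to at most [1/2 <= (3/4)^2]. *)
Lemma gauss_betap_le (R : realType) (k : nat) (x : R) :
  0 <= x < 1 -> gauss_betap k x <= 2 * (3 / 4) ^+ k.
Proof.
move=> x01; suff : gauss_betap k x <= 2 * (3 / 4) ^+ k /\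
    gauss_betap k.+1 x <= 2 * (3 / 4) ^+ k.+1 by case.
elim: k => [|k [IH1 IH2]].
  have /andP[x0 x1] := x01.
  by rewrite gauss_betapS /gauss_betap big_ord0 mul1r expr0 expr1 /gauss_alpha /=; lra.
split => //; rewrite 2!gauss_betapS -mulrA gauss_alphaS.
have h := mul_gauss_le_half (gauss_alpha_itv k x01).
have b0 := gauss_betap_ge0 k x01.
have e0 : 0 <= (3 / 4) ^+ k :> R by rewrite exprn_ge0//; lra.
rewrite !exprS; nra.
Qed.

(** Lengths of the successive partial sums when the reciprocity law is iterated
    from the sum of length [N] at [x]. *)
Fixpoint descent (R : realType) (x : R) (N k : nat) : nat :=
  if k is k'.+1 then Num.truncn ((descent x N k')%:R * gauss_alpha k' x) else N.

Lemma phi1_descent (R : realType) (x : R) (N K : nat) :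
  series (phi1_term x) N =
    \sum_(k < K) (-1) ^+ k * gauss_betap k x *
      (series (phi1_term (gauss_alpha k x)) (descent x N k)
       + gauss_alpha k x *
         series (phi1_term (gauss_alpha k x)^-1) (descent x N k.+1))
    + (-1) ^+ K * gauss_betap K x *
      series (phi1_term (gauss_alpha K x)) (descent x N K).
Proof.
elim: K => [|K IH].
  by rewrite big_ord0 /gauss_betap big_ord0 expr0 !mul1r add0r.
have -> : phi1_term (gauss_alpha K.+1 x) = phi1_term (gauss_alpha K x)^-1.
  by rewrite phi1_term_gauss.
by rewrite big_ord_recr [LHS]IH gauss_betapS exprS /=; ring.
Qed.

Lemma descent_le (R : realType) (x : R) (N k : nat) :
  0 <= x < 1 -> (descent x N k <= N - k)%N.
Proof.
move=> x01; elim: k => [|k IH]; first by rewrite subn0.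
have [a0 a1] := andP (gauss_alpha_itv k x01).
case: (posnP (descent x N k)) => [d0|d0].
  by rewrite /= d0 mul0r truncn0.
rewrite subnS; apply: (@leq_trans (descent x N k).-1); last first.
  by rewrite -!subn1 leq_sub2r.
rewrite -ltnS prednK//= truncn_lt_nat ?mulr_ge0//.
by rewrite gtr_pMr// ltr0n.
Qed.

Lemma descent_half (R : realType) (x : R) (N k : nat) : 0 <= x < 1 ->
  2 * (descent x N k.+2)%:R <= (descent x N k)%:R :> R.
Proof.
move=> x01.
have [a0 a1] := andP (gauss_alpha_itv k x01).
have [b0 b1] := andP (gauss_alpha_itv k.+1 x01).
have h : gauss_alpha k x * gauss_alpha k.+1 x <= 2^-1.
  exact: mul_gauss_le_half (gauss_alpha_itv k x01).
have le1 : (descent x N k.+1)%:R <= (descent x N k)%:R * gauss_alpha k x.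
  by rewrite truncn_le mulr_ge0.
have le2 : (descent x N k.+2)%:R <= (descent x N k.+1)%:R * gauss_alpha k.+1 x.
  by rewrite truncn_le mulr_ge0.
have d0 : 0 <= (descent x N k)%:R :> R by [].
by nra.
Qed.

Lemma descent_eq0 (R : realType) (x : R) (N j k : nat) :
  (j <= k)%N -> descent x N j = 0%N -> descent x N k = 0%N.
Proof.
move=> jk dj; rewrite -(subnKC jk); elim: (k - j)%N => [|i IH].
  by rewrite addn0.
by rewrite addnS /= IH mul0r truncn0.
Qed.

(** Read backwards from the last positive length [descent x N L >= 1], the lengths
    double every two steps, and [2 >= (4/3)^2]. *)
Lemma descent_growth (R : realType) (x : R) (N L j : nat) :
  0 <= x < 1 -> (0 < descent x N L)%N -> (j <= L)%N ->
  2^-1 * (4 / 3) ^+ j <= (descent x N (L - j))%:R :> R.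
Proof.
move=> x01 dL; have pos k : (k <= L)%N -> 1 <= (descent x N k)%:R :> R.
  move=> kL; rewrite ler1n lt0n; apply: contraTneq dL => dk.
  by rewrite (descent_eq0 kL dk).
elim/ltn_ind: j => -[|[|j]] IH jL.
- by rewrite expr0 mulr1 subn0; have := pos L (leqnn _); lra.
- by rewrite expr1; have := pos (L - 1)%N (leq_subr _ _); lra.
- have jL' : (j <= L)%N by rewrite (leq_trans _ jL)// -addn2 leq_addr.
  have := IH j (leqnSn j.+1) jL'.
  have := descent_half N (L - j.+2) x01.
  have -> : (L - j.+2).+2 = (L - j)%N by lia.
  have e0 : 0 <= (4 / 3) ^+ j :> R by rewrite exprn_ge0//; lra.
  by rewrite !exprS; nra.
Qed.

Lemma descent_infty (R : realType) (x : R) (k m : nat) :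
  irrational x -> 0 <= x < 1 -> exists N0 : nat,
  forall N : nat, (N0 <= N)%N -> (m <= descent x N k)%N.
Proof.
move=> ix x01; elim: k m => [|k IH] m; first by exists m.
have a0 := gauss_alpha_gt0 k ix x01.
have [N0 hN0] := IH (Num.truncn (m%:R / gauss_alpha k x)).+1.
exists N0 => N /hN0 h /=; rewrite truncn_ge_nat; last by rewrite mulr_ge0// ltW.
by rewrite -ler_pdivrMr// ltW// (lt_le_trans (truncnS_gt _))// ler_nat.
Qed.

Lemma descent_last (R : realType) (x : R) (N : nat) :
  0 <= x < 1 -> (0 < N)%N ->
  exists L : nat, (0 < descent x N L)%N /\ descent x N L.+1 = 0%N.
Proof.
move=> x01 N0; have ex : exists k, descent x N k == 0%N.
  by exists N; rewrite -leqn0 (leq_trans (descent_le _ _ x01))// subnn.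
case: (ex_minnP ex) => -[|L] /eqP d0 dmin.
  by move: N0; rewrite /= in d0; rewrite d0.
exists L; split=> //; rewrite lt0n; apply/negP => /dmin.
by rewrite ltnn.
Qed.

(** * Convergence at the points where Wilton's series converges *)

Definition wilton_defect_term (R : realType) (y : R) : R^nat :=
  fun k => (-1) ^+ k * gauss_betap k y * recip_defect (gauss_alpha k y).

Definition wilton_defect (R : realType) (x : R) : R :=
  limn (series (wilton_defect_term (fracpart x))).

Lemma recip_bound_ge0 (R : realType) : 0 <= recip_bound R.
Proof. by rewrite !addr_ge0. Qed.

(** The term of rank [k] is at most
    [2 C (3/4)^k = 8 C (3/4)^k - 8 C (3/4)^(k + 1)], uniformly in [y]. *)
Lemma dist_wilton_defect (R : realType) (y : R) (n : nat) : 0 <= y < 1 ->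
  `|series (wilton_defect_term y) n - limn (series (wilton_defect_term y))|
    <= 8 * recip_bound R * (3 / 4) ^+ n.
Proof.
move=> y01; have C0 := recip_bound_ge0 R; move: n.
apply: dist_limn_telescope => [k|]; last first.
  by apply: cvg_geometric; rewrite ger0_norm; lra.
rewrite distrC seriesSB exprS.
have e0 : 0 <= (3 / 4) ^+ k :> R by rewrite exprn_ge0//; lra.
have b0 := gauss_betap_ge0 k y01; have b1 := gauss_betap_le k y01.
have : `|recip_defect (gauss_alpha k y)| <= recip_bound R.
  by apply: recip_defect_le; have /andP[-> /ltW] := gauss_alpha_itv k y01.
rewrite /wilton_defect_term !normrM normrX normrN1 expr1n mul1r (ger0_norm b0).
have := normr_ge0 (recip_defect (gauss_alpha k y)).
by move: (`|recip_defect _|) => r r0 r1; nra.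
Qed.

(** The rank [L] depends on [N] in an uncontrolled way; it only has to tend to
    infinity. *)
Lemma cvg_along (R : realType) (s A D : R^nat) (l : R) :
  (forall k, exists N0, forall N, (N0 <= N)%N ->
    exists2 L, (k <= L)%N & `|s N - A L.+1| <= D L) ->
  A @ \oo --> l -> D @ \oo --> 0 -> s @ \oo --> l.
Proof.
move=> h /cvgrPdist_lt cA /cvgrPdist_lt cD; apply/cvgrPdist_lt => e e0.
have e20 : 0 < e / 2 by lra.
have [k1 _ h1] := cA _ e20; have [k2 _ h2] := cD _ e20.
have [N0 hN0] := h (maxn k1 k2); exists N0 => // N /= /hN0 [L].
rewrite geq_max => /andP[k1L k2L] hL.
have := h1 L.+1 (leqW k1L); have := h2 L k2L; rewrite /= sub0r normrN => d2 d1.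
have -> : l - s N = (l - A L.+1) - (s N - A L.+1) by ring.
apply: le_lt_trans (ler_normB _ _) _.
have := ler_norm (D L); lra.
Qed.

(** The error of the step [k < L] is [15 / N_(k+1)] weighted by [beta_(k-1)]. The
    weight decays forwards like [(3/4)^k] and [1 / N_(k+1)] decays backwards like
    [(3/4)^(L - k - 1)], so that each of the [L] products is of order [(3/4)^L].
    The last step contributes the two terms that do not carry this factor. *)
Lemma wilton_error (R : realType) (x : R) (N L : nat) :
  irrational x -> 0 < x < 1 ->
  (0 < descent x N L)%N -> descent x N L.+1 = 0%N ->
  `|series (phi1_term x) N -
    series (fun k => - 2^-1 * ((-1) ^+ k * gauss_gamma k x)
                     + wilton_defect_term x k) L.+1|
  <= 80 * (L%:R * (3 / 4) ^+ L) + recip_bound R * gauss_betap L x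
     + 2^-1 * gauss_gamma L x.
Proof.
move=> ix x01 dL dL1.
have x01' : 0 <= x < 1 by have /andP[/ltW -> ->] := x01.
pose err k := recip_error (gauss_alpha k x) (descent x N k).
have a01 k : 0 < gauss_alpha k x < 1.
  by rewrite gauss_alpha_gt0//=; have /andP[] := gauss_alpha_itv k x01'.
have -> : series (phi1_term x) N -
    series (fun k => - 2^-1 * ((-1) ^+ k * gauss_gamma k x)
                     + wilton_defect_term x k) L.+1
    = \sum_(k < L.+1) (-1) ^+ k * gauss_betap k x * err k.
  have serE (u : R^nat) n : series u n = \sum_(k < n) u k.
    by rewrite /series /= big_mkord.
  rewrite (phi1_descent _ _ L.+1) dL1 [series _ 0]serE big_ord0 mulr0 addr0.
  rewrite [series _ L.+1]serE -sumrB; apply: eq_bigr => k _.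
  rewrite /gauss_gamma /wilton_defect_term /err /recip_error lnV; last first.
    by rewrite posrE; have /andP[] := a01 k.
  rewrite -[Num.truncn _]/(descent x N k.+1); ring.
apply: le_trans (ler_norm_sum _ _ _) _; rewrite big_ord_recr /= -addrA.
have norm_term k :
    `|(-1) ^+ k * gauss_betap k x * err k| = gauss_betap k x * `|err k|.
  by rewrite !normrM normrX normrN1 expr1n mul1r (ger0_norm (gauss_betap_ge0 k x01')).
have ia k : irrational (gauss_alpha k x) by exact: gauss_alpha_irrational.
apply: lerD; last first.
  rewrite norm_term /gauss_gamma mulrCA [recip_bound R * _]mulrC -mulrDr.
  apply: ler_wpM2l; first exact: gauss_betap_ge0.
  exact: (recip_error_last (ia L) (a01 L) dL dL1).
have -> : 80 * (L%:R * (3 / 4) ^+ L) = \sum_(k < L) 80 * (3 / 4) ^+ L :> R.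
  by rewrite sumr_const card_ord -[RHS]mulr_natl; ring.
apply: ler_sum => k _; rewrite norm_term.
have kL : (k < L)%N by [].
have dk : (0 < descent x N k.+1)%N.
  rewrite lt0n; apply: contraTneq dL => dk; rewrite -leqNgt leqn0.
  by rewrite (descent_eq0 kL dk).
have ek : `|err k| <= 15 / (descent x N k.+1)%:R.
  exact: (recip_error_pos (ia k) (a01 k) dk).
have := descent_growth x01' dL (leq_subr k.+1 L).
rewrite subKn// => gr.
have c0 : 0 < (4 / 3) ^+ (L - k.+1) :> R by rewrite exprn_gt0//; lra.
have {}ek : `|err k| <= 30 * (3 / 4) ^+ (L - k.+1).
  apply: (le_trans ek); rewrite ler_pdivrMr ?ltr0n//.
  have -> : 15 = 30 * (3 / 4) ^+ (L - k.+1) * (2^-1 * (4 / 3) ^+ (L - k.+1)) :> R.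
    rewrite -[3 / 4]invf_div exprVn; field; rewrite gt_eqF//.
  by apply: ler_wpM2l => //; rewrite mulr_ge0// exprn_ge0//; lra.
apply: (@le_trans _ _ ((2 * (3 / 4) ^+ k) * (30 * (3 / 4) ^+ (L - k.+1)))).
  by apply: ler_pM => //; [exact: gauss_betap_ge0|exact: gauss_betap_le].
rewrite le_eqVlt; apply/orP; left; apply/eqP.
by rewrite -[in RHS](subnKC kL) exprD exprS; field.
Qed.

(** Bernoulli's inequality for [(16/15)^n]. *)
Lemma natr_geometric_le (R : realType) (n : nat) :
  n%:R * (3 / 4) ^+ n <= 15 * (4 / 5) ^+ n :> R.
Proof.
have -> : 3 / 4 = (15 / 16) * (4 / 5) :> R by field.
rewrite exprMn mulrA; apply: ler_wpM2r; first by rewrite exprn_ge0//; lra.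
have g0 : 0 < (16 / 15) ^+ n :> R by rewrite exprn_gt0// divr_gt0.
rewrite -[15 / 16]invf_div exprVn ler_pdivrMr// {g0}.
elim: n => [|k IH]; first by rewrite expr0; lra.
have e1 : 1 <= (16 / 15) ^+ k :> R by rewrite exprn_ege1//; lra.
by rewrite -natr1 exprS; lra.
Qed.

Lemma cvg_natr_geometric (R : realType) :
  (fun n => n%:R * (3 / 4) ^+ n : R) @ \oo --> 0.
Proof.
apply: (@squeeze_cvgr _ _ _ _ (cst 0) (geometric 15 (4 / 5))).
- near=> n => /=; rewrite natr_geometric_le andbT.
  by rewrite mulr_ge0// exprn_ge0//; lra.
- exact: cvg_cst.
- by apply: cvg_geometric; rewrite ger0_norm; lra.
Unshelve. all: by end_near. Qed.

(** The error bound of [wilton_error] tends to [0] because the general term of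
    the convergent Wilton series does, and the last rank [L] tends to infinity
    with [N] because each fixed [descent x N k] does. *)
Lemma phi1_wilton_pointwise (R : realType) (x : R) :
  irrational x -> cvgn (series (wilton_term x)) ->
  series (phi1_term x) @ \oo --> - 2^-1 * wilton x + wilton_defect x.
Proof.
move=> ix cw; set y := fracpart x.
have iy : irrational y by exact: irrational_fracpart.
have y01 : 0 < y < 1 by rewrite irrational_fracpart_gt0//= fracpart_lt1.
have y01' : 0 <= y < 1 by have /andP[/ltW -> ->] := y01.
rewrite -phi1_term_fracpart -/y.
pose D L := 80 * (L%:R * (3 / 4) ^+ L) + recip_bound R * gauss_betap L y
     + 2^-1 * gauss_gamma L y.
pose A := series (fun k => - 2^-1 * wilton_term x k + wilton_defect_term y k).
have q1 : `|3 / 4| < 1 :> R by rewrite ger0_norm; lra.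
apply: (@cvg_along _ _ A D).
- move=> k; have [N0 hN0] := descent_infty k 1 iy y01'.
  exists N0.+1 => N N0N.
  (* [L] is the last rank at which the length is positive. *)
  have [L [dL dL1]] := descent_last y01' (leq_ltn_trans (leq0n _) N0N).
  exists L; last exact: wilton_error.
  rewrite leqNgt; apply/negP => Lk; have := hN0 N (ltnW N0N).
  by rewrite (descent_eq0 Lk dL1).
- have -> : A = (fun n => - 2^-1 * series (wilton_term x) n
                           + series (wilton_defect_term y) n).
    apply/funext => n; rewrite /A /series /= mulr_sumr -big_split//.
  apply: cvgD; first by apply: cvgM => //; exact: cvg_cst.
  apply/cvgrPdist_lt => e e0; have C0 := recip_bound_ge0 R.
  have /cvgrPdist_lt /(_ e e0) := cvg_geometric (8 * recip_bound R) q1.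
  apply: filterS => n /=; rewrite sub0r normrN.
  apply: le_lt_trans; rewrite distrC.
  by apply: le_trans (dist_wilton_defect n y01') (ler_norm _).
- have gto0 : (fun k => gauss_gamma k y) @ \oo --> (0 : R).
    have /cvgrPdist_lt cw0 := cvg_series_cvg_0 cw.
    apply/cvgrPdist_lt => e /cw0; apply: filterS => k.
    by rewrite !sub0r !normrN /wilton_term normrM normrX normrN1 expr1n mul1r.
  have bto0 : (fun k => gauss_betap k y) @ \oo --> (0 : R).
    apply: (@squeeze_cvgr _ _ _ _ (cst 0) (geometric 2 (3 / 4))).
    + by near=> k; rewrite gauss_betap_ge0//= gauss_betap_le.
    + exact: cvg_cst.
    + exact: cvg_geometric.
  have -> : 0 = 80 * 0 + recip_bound R * 0 + 2^-1 * 0 :> R by rewrite !mulr0 !addr0.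
  apply: cvgD; first apply: cvgD.
  + by apply: cvgM; [exact: cvg_cst|exact: cvg_natr_geometric].
  + by apply: cvgM; [exact: cvg_cst|].
  + by apply: cvgM; [exact: cvg_cst|].
Unshelve. all: by end_near. Qed.

(** * Almost everywhere convergence of Wilton's series *)

(** Then [ln (1 / alpha_k) <= k] and the terms are at most [2 k (3/4)^k]. *)
Lemma wilton_cvg (R : realType) (x : R) (k0 : nat) :
  (forall k, (k0 <= k)%N -> 2^-1 ^+ k <= gauss_alpha k (fracpart x)) ->
  cvgn (series (wilton_term x)).
Proof.
move=> ak; set y := fracpart x in ak *.
have y01 : 0 <= y < 1 by rewrite fracpart_ge0 fracpart_lt1.
apply: normed_cvg; rewrite -(is_cvg_series_restrict k0).
pose v := geometric (30 : R) (4 / 5).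
have cv : cvgn (fun n => \sum_(k0 <= k < n) v k).
  rewrite is_cvg_series_restrict; apply: is_cvg_geometric_series.
  by rewrite ger0_norm; lra.
have wv k : (k0 <= k)%N -> `|wilton_term x k| <= v k.
  move=> k0k; rewrite /wilton_term normrM normrX normrN1 expr1n mul1r -/y.
  have a2 := ak k k0k; have a0 : 0 < gauss_alpha k y.
    by apply: lt_le_trans a2; rewrite exprn_gt0// invr_gt0.
  have [_ /ltW a1] := andP (gauss_alpha_itv k y01).
  have V1 : 1 <= (gauss_alpha k y)^-1 by rewrite invf_ge1.
  have ln2 : ln 2 <= 1 :> R by rewrite -[2]/(1 + 1) le_ln1Dx//; lra.
  have lnk : ln (gauss_alpha k y)^-1 <= k%:R.
    apply: (@le_trans _ _ (ln (2 ^+ k))).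
      rewrite ler_ln ?posrE ?exprn_gt0// ?invr_gt0//.
      by rewrite -[2]invrK exprVn lef_pV2 ?posrE// exprn_gt0// invr_gt0.
    by rewrite lnXn// -[ln 2 *+ k]mulr_natl ler_piMr.
  rewrite /gauss_gamma ger0_norm; last first.
    by rewrite mulr_ge0 ?gauss_betap_ge0// ln_ge0.
  apply: (@le_trans _ _ (2 * (3 / 4) ^+ k * k%:R)).
    by apply: ler_pM => //; [exact: gauss_betap_ge0|exact: ln_ge0|exact: gauss_betap_le].
  by have := natr_geometric_le R k; rewrite /v /geometric /=; lra.
apply: nondecreasing_is_cvgn.
  by apply: nondecreasing_series => n _ _; exact: normr_ge0.
have /bounded_fun_has_ubound[B vB] := cvg_seq_bounded cv.
exists B => _ [n _ <-]; apply: le_trans (vB _ (ex_intro2 _ _ n Logic.I erefl)).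
by rewrite /= big_nat [leRHS]big_nat; apply: ler_sum => i /andP[ki _]; exact: wv.
Qed.

Lemma nneseries_le_bound (R : realType) (v : (\bar R)^nat) (u : R^nat) (B : R) :
  (forall n, 0 <= v n)%E -> (forall n, (v n <= (u n)%:E)%E) ->
  (forall n, \sum_(0 <= i < n) u i <= B) -> (\sum_(n <oo) v n <= B%:E)%E.
Proof.
move=> v0 vu uB; apply: lime_le; first exact: is_cvg_nneseries.
apply: nearW => n; apply: (@le_trans _ _ (\sum_(0 <= i < n) (u i)%:E)%E).
  exact: lee_sum.
by rewrite sumEFin lee_fin.
Qed.

(** Keeping every interval [(z, z + 1)] instead of [(0, 1)] alone avoids any
    transport of null sets by translation. *)
Definition gauss_preimage (R : realType) (z : int) (k : nat) (a b : R) : set R :=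
  [set x | z%:~R < x < z%:~R + 1 /\ a < gauss_alpha k (x - z%:~R) < b].

Lemma gauss_preimage0 (R : realType) (z : int) (a b : R) : 0 <= a -> b <= 1 ->
  gauss_preimage z 0 a b = [set` `]z%:~R + a, z%:~R + b[].
Proof.
move=> a0 b1; apply/seteqP; split => x; rewrite /gauss_preimage /= in_itv/=.
  by move=> [_]; rewrite /gauss_alpha/=; lra.
by rewrite /gauss_alpha/= => h; split; lra.
Qed.

(** The branches of the Gauss map are [1 / y - (j + 1)] on
    [(1 / (j + 2), 1 / (j + 1))], and the bounds [0 <= a] and [b <= 1] make the
    inverse image of [(a, b)] by each branch a single interval. *)
Lemma gauss_preimageS (R : realType) (z : int) (k : nat) (a b : R) :
  0 <= a -> a < b -> b <= 1 ->
  gauss_preimage z k.+1 a b =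
  \bigcup_j gauss_preimage z k ((j.+1%:R + b)^-1) ((j.+1%:R + a)^-1).
Proof.
move=> a0 ab b1; apply/seteqP; split => x.
  move=> [zx]; set y := x - _; rewrite gauss_alphaS /gauss => hy.
  have y01 : 0 <= y < 1 by rewrite /y; lra.
  have [c0 c1] := andP (gauss_alpha_itv k y01).
  have {}c0 : 0 < gauss_alpha k y.
    rewrite lt_def c0 andbT; apply: contraTneq hy => ->.
    by rewrite invr0 fracpart_id ?lexx//=; lra.
  have V1 : 1 < (gauss_alpha k y)^-1 by rewrite invf_gt1.
  have n0 : (0 < Num.truncn (gauss_alpha k y)^-1)%N by rewrite truncn_gt0 ltW.
  exists (Num.truncn (gauss_alpha k y)^-1).-1 => //; split => //.
  move: hy; rewrite prednK// fracpart_truncn; last by lra.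
  rewrite -/y; set c := gauss_alpha k y in c0 c1 V1 *.
  have : 0 <= (Num.truncn c^-1)%:R :> R by [].
  move: (_%:R : R) => n nn0 hn.
  rewrite -[c]invrK !ltf_pV2 ?posrE//; lra.
move=> [j _ [zx]]; set y := x - _ => hy; split => //.
have [y0 y1] : 0 <= y /\ y < 1 by rewrite /y; lra.
have j0 : 0 <= j%:R :> R by [].
rewrite gauss_alphaS -/y; set c := gauss_alpha k y in hy *.
have jb : 0 < j.+1%:R + b by rewrite -natr1; lra.
have ja : 0 < j.+1%:R + a by rewrite -natr1; lra.
have [h1 h2] := andP hy.
have c0 : 0 < c by apply: lt_trans h1; rewrite invr_gt0.
have V1 : c^-1 < j.+1%:R + b by rewrite -[X in _ < X]invrK ltf_pV2 ?posrE// invr_gt0.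
have V2 : j.+1%:R + a < c^-1 by rewrite -[X in X < _]invrK ltf_pV2 ?posrE// invr_gt0.
rewrite /gauss fracpart_truncn; last by rewrite invr_ge0 ltW.
rewrite (@truncn_def _ _ j.+1); first by lra.
by rewrite -(natr1 j.+1); lra.
Qed.

(** The Gauss measure [ln ((1 + b) / (1 + a))] of an interval is the sum of the
    measures of its inverse images by the branches, a telescoping series. Hence
    the domination of the law of [alpha_k] by twice this measure passes from [k]
    to [k + 1] by countable subadditivity. *)
Lemma gauss_preimage_measure (R : realType) (z : int) (k : nat) (a b : R) :
  0 <= a -> a < b -> b <= 1 ->
  measurable (gauss_preimage z k a b) /\
  (lebesgue_measure (gauss_preimage z k a b) <= (2 * (ln (1 + b) - ln (1 + a)))%:E)%E.
Proof.
elim: k a b => [|k IH] a b a0 ab b1.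
  rewrite gauss_preimage0//; split; first exact: measurable_itv.
  rewrite lebesgue_measure_itv/= lte_fin ltrD2l ab -EFinB lee_fin.
  have a1 : 0 < 1 + a by lra.
  have b2 : 0 < 1 + b by lra.
  have /andP[lo _] := ln_sub_bounds a1 b2.
  have -> : z%:~R + b - (z%:~R + a) = 2 * ((b - a) / 2) by field.
  rewrite ler_pM2l//; apply: le_trans lo.
  have -> : 1 + b - (1 + a) = b - a by ring.
  by rewrite ler_pM2l ?lef_pV2 ?posrE; lra.
have side j : [/\ 0 <= (j.+1%:R + b)^-1, (j.+1%:R + b)^-1 < (j.+1%:R + a)^-1
    & (j.+1%:R + a)^-1 <= 1].
  have j0 : 0 <= j%:R :> R by [].
  rewrite -natr1; split; first by rewrite invr_ge0; lra.
    by rewrite ltf_pV2 ?posrE; lra.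
  by rewrite invf_le1; lra.
have mF j : measurable (gauss_preimage z k (j.+1%:R + b)^-1 (j.+1%:R + a)^-1).
  by have [s1 s2 s3] := side j; have [] := IH _ _ s1 s2 s3.
rewrite gauss_preimageS//; split; first exact: bigcupT_measurable.
have mU := bigcupT_measurable _ mF.
have := measure_sigma_subadditive (@lebesgue_measure R) mF mU (@subset_refl _ _).
move=> /le_trans; apply.
(* The inductive bound, by
   [1 + 1 / (j + 1 + c) = (j + 2 + c) / (j + 1 + c)] for [c = a] and [c = b]. *)
pose u j : R := 2 * ((ln (j.+2%:R + a) - ln (j.+1%:R + a))
                    - (ln (j.+2%:R + b) - ln (j.+1%:R + b))).
apply: (@nneseries_le_bound R _ u) => [//|j|n].
  have [s1 s2 s3] := side j; have [_ le1] := IH _ _ s1 s2 s3.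
  apply: le_trans le1 _; rewrite lee_fin /u ler_pM2l//.
  have j0 : 0 <= j%:R :> R by [].
  have ja : 0 < j.+1%:R + a by rewrite -natr1; lra.
  have jb : 0 < j.+1%:R + b by rewrite -natr1; lra.
  have rec (c : R) : 0 < j.+1%:R + c ->
      ln (1 + (j.+1%:R + c)^-1) = ln (j.+2%:R + c) - ln (j.+1%:R + c).
    move=> c0; rewrite -ln_div ?posrE//; last by rewrite -(natr1 j.+1); lra.
    by congr ln; rewrite -(natr1 j.+1); field; rewrite nat1r gt_eqF.
  by rewrite !rec.
rewrite /u -mulr_sumr ler_pM2l//.
have tel (c : R) : \sum_(0 <= i < n) (ln (i.+2%:R + c) - ln (i.+1%:R + c))
    = ln (n.+1%:R + c) - ln (1 + c).
  exact: (@telescope_sumr _ 0 n (fun i => ln (i.+1%:R + c))).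
rewrite sumrB !tel.
have n0 : 0 <= n%:R :> R by [].
have : ln (n.+1%:R + a) <= ln (n.+1%:R + b).
  by rewrite ler_ln ?posrE -?natr1; lra.
by lra.
Qed.

Lemma ae_irrational (R : realType) :
  {ae @lebesgue_measure R, forall x, irrational x}.
Proof.
have cQ : countable (@rational R).
  exact: (sub_countable (card_image_le _ _) (countableP _)).
exists rational; split.
- exact: countable_measurable.
- exact: countable_lebesgue_measure0.
- by move=> x /= /contrapT.
Qed.

(** Borel-Cantelli: the [k]-th set has measure at most [2 * 2^-k]. *)
Lemma limsup_gauss_preimage_null (R : realType) (z : int) :
  (@lebesgue_measure R).-negligible
    (lim_sup_set (fun k => gauss_preimage z k 0 (2^-1 ^+ k))).
Proof.
have F k : measurable (gauss_preimage z k (0 : R) (2^-1 ^+ k)) /\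
  (lebesgue_measure (gauss_preimage z k 0 (2^-1 ^+ k : R)) <= (2 * 2^-1 ^+ k)%:E)%E.
  have q0 : 0 < 2^-1 ^+ k :> R by rewrite exprn_gt0 ?invr_gt0.
  have q1 : 2^-1 ^+ k <= 1 :> R by rewrite exprn_ile1 ?invr_ge0 ?invf_le1 ?ler1n.
  have [mC leC] := gauss_preimage_measure z k (lexx 0) q0 q1; split => //.
  apply: le_trans leC _; rewrite lee_fin ler_pM2l// addr0 ln1 subr0.
  by apply: le_ln1Dx; lra.
have mF k := (F k).1; have leF k := (F k).2.
have mL : measurable (lim_sup_set (fun k => gauss_preimage z k (0 : R) (2^-1 ^+ k))).
  apply: bigcapT_measurable => n; apply: bigcup_measurable => k _; exact: mF.
apply/negligibleP; first exact: mL.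
apply: lim_sup_set_cvg0 => //.
apply: (@le_lt_trans _ _ (4%:E)); last exact: ltry.
apply: (nneseries_le_bound _ leF) => [//|n].
rewrite -mulr_sumr.
suff -> : \sum_(0 <= i < n) 2^-1 ^+ i = 2 * (1 - 2^-1 ^+ n) :> R.
  have : 0 <= 2^-1 ^+ n :> R by rewrite exprn_ge0 ?invr_ge0.
  by lra.
elim: n => [|n IH]; first by rewrite big_geq// expr0; lra.
by rewrite big_nat_recr//= IH exprS; lra.
Qed.

Lemma ae_wilton_cvg (R : realType) :
  {ae @lebesgue_measure R, forall x,
     irrational x /\ cvgn (series (wilton_term x))}.
Proof.
(* One exceptional set for each unit interval, enumerated by [unpickle]. *)
pose P (i : nat) (x : R) := if unpickle i is Some z then
  ~ lim_sup_set (fun k => gauss_preimage z k 0 (2^-1 ^+ k)) x else True.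
have aeP : {ae @lebesgue_measure R, forall x, forall i, P i x}.
  apply: ae_foralln => i; rewrite /P; case: (unpickle i) => [z|]; last exact: aeW.
  apply: negligibleS (limsup_gauss_preimage_null R z) => x /=.
  by move=> /contrapT.
have aeF := ae_filter_ringOfSetsType (@lebesgue_measure R).
apply: filterS2 (@ae_irrational R) aeP => x ix Px; split => //.
have := Px (pickle (Num.floor x)); rewrite /P pickleK.
rewrite /lim_sup_set /bigcap /= => /existsNP[k0 /not_implyP[_ nk0]].
apply: (@wilton_cvg R x k0) => k k0k; rewrite leNgt; apply/negP => ak.
apply: nk0; exists k => //; rewrite /gauss_preimage /=.
rewrite -/(fracpart x) ak andbT; split.
  have := irrational_fracpart_gt0 ix; have := fracpart_lt1 x.
  by rewrite /fracpart; lra.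
apply: gauss_alpha_gt0; first exact: irrational_fracpart.
by rewrite fracpart_ge0 fracpart_lt1.
Qed.

(** * Continuity at irrational points *)

Lemma continuous_near_eq (R : realType) (f g : R -> R) (x : R) :
  {near x, f =1 g} -> {for x, continuous g} -> {for x, continuous f}.
Proof.
move=> fg cg; rewrite /prop_for /continuous_at (nbhs_singleton fg).
apply: cvg_trans cg; apply: near_eq_cvg.
by apply: filterS fg => y ->.
Qed.

(** Used with [u n] the partial sums of [defect_series], then of
    [wilton_defect]. *)
Lemma continuous_dist_le (R : realType) (u : nat -> R -> R) (f : R -> R)
    (d : R^nat) (x : R) :
  (forall n y, `|u n y - f y| <= d n) -> d @ \oo --> 0 ->
  (forall n, {for x, continuous (u n)}) -> {for x, continuous f}.
Proof.
move=> uf /cvgrPdist_lt d0 cu; apply/cvgrPdist_lt => e e0.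
have e30 : 0 < e / 3 by lra.
have [n _ /(_ n (leqnn n))] := d0 _ e30; rewrite /= sub0r normrN => dn.
have /cvgrPdist_lt /(_ _ e30) := cu n; apply: filterS => y uy.
have -> : f x - f y = - (u n x - f x) + (u n y - f y) + (u n x - u n y) by ring.
apply: le_lt_trans (ler_normD _ _) _.
have := ler_normD (- (u n x - f x)) (u n y - f y); rewrite normrN.
have := uf n x; have := uf n y; have := ler_norm (d n); lra.
Qed.

Lemma continuous_comp_fun (R : realType) (f g : R -> R) (x : R) :
  {for x, continuous f} -> {for f x, continuous g} ->
  {for x, continuous (fun y => g (f y))}.
Proof. by move=> cf cg; exact: (continuous_comp cf cg). Qed.

Lemma near_floor (R : realType) (x : R) : irrational x ->
  \forall y \near x, Num.floor y = Num.floor x.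
Proof.
move=> ix; have x1 : (Num.floor x)%:~R < x.
  rewrite lt_neqAle floor_le andbT; apply/eqP => xE.
  by have := irrational_nint ix; rewrite -xE intr_int.
have x2 := floorD1_gt x.
near=> y; apply: floor_def; apply/andP; split.
  by apply: ltW; near: y; exact: lt_nbhsr.
by near: y; exact: lt_nbhsl.
Unshelve. all: by end_near. Qed.

Lemma continuous_fracpart (R : realType) (x : R) : irrational x ->
  {for x, continuous (@fracpart R)}.
Proof.
move=> ix; apply: (@continuous_near_eq _ _ (fun y => y - (Num.floor x)%:~R)).
  by apply: filterS (near_floor ix) => y; rewrite /fracpart => ->.
by apply: cvgB; [exact: cvg_id|exact: cvg_cst].
Qed.

(** Away from the integers [y] the floor is locally constant, and the formula is
    then a combination of [ln] and of rational functions. *)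
Lemma continuous_harmonic_defect (R : realType) (y : R) :
  irrational y -> 0 < y ->
  {for y, continuous (@harmonic_defect R)}.
Proof.
move=> iy y0; have [y1|y1] := ltP y 1.
  apply: (@continuous_near_eq _ _ (cst 0)); last exact: cvg_cst.
  by near=> t; rewrite /harmonic_defect ifT//; near: t; exact: lt_nbhsl.
have {}y1 : 1 < y.
  rewrite lt_neqAle y1 andbT; apply/eqP => yE.
  by have := irrational_nint iy; rewrite -yE int_num1.
apply: (@continuous_near_eq _ _ (fun t => series harmonic (Num.truncn y) - ln t
   - euler_gamma R + (t - (Num.floor y)%:~R - 2^-1) / t)).
  near=> t; have t1 : 1 < t by near: t; exact: lt_nbhsr.
  have ft : Num.floor t = Num.floor y by near: t; exact: near_floor.
  rewrite /harmonic_defect ltNge ltW//= /fracpart ft.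
  by rewrite !truncn_floor ft !ifT//; lra.
apply: cvgD; first apply: cvgB; first apply: cvgB.
- exact: cvg_cst.
- exact: continuous_ln.
- exact: cvg_cst.
apply: cvgM; last by apply: cvgV; [rewrite gt_eqF|exact: cvg_id].
by apply: cvgB; [apply: cvgB; [exact: cvg_id|exact: cvg_cst]|exact: cvg_cst].
Unshelve. all: by end_near. Qed.

Lemma continuous_series_n (R : realType) (u : nat -> R -> R) (n : nat) (x : R) :
  (forall k, {for x, continuous (u k)}) ->
  {for x, continuous (fun y => series (u ^~ y) n)}.
Proof.
move=> cu; have -> : (fun y => series (u ^~ y) n) = (fun y => \sum_(k < n) u k y).
  by apply/funext => y; rewrite /series /= big_mkord.
elim: n => [|n IH].
  have -> : (fun y => \sum_(k < 0) u k y) = cst 0.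
    by apply/funext => y; rewrite big_ord0.
  exact: cvg_cst.
have -> : (fun y => \sum_(k < n.+1) u k y) = (fun y => \sum_(k < n) u k y + u n y).
  by apply/funext => y; rewrite big_ord_recr.
by apply: cvgD; [exact: IH|exact: cu].
Qed.

Lemma continuous_recip_defect (R : realType) (x : R) :
  irrational x -> 0 < x < 1 -> {for x, continuous (@recip_defect R)}.
Proof.
move=> ix x01; have /andP[x0 x1] := x01.
apply: cvgD.
  apply: cvgB; first exact: cvg_cst.
  by apply: cvgM; [exact: cvg_id|exact: cvg_cst].
apply: (@continuous_dist_le _ (fun n y => series (defect_term y) n) _
  (fun n => 10 / n.+1%:R)).
- by move=> n y; exact: dist_defect_series.
- by have := cvgM (cvg_cst (10 : R)) (@cvg_harmonic R); rewrite mulr0; apply.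
move=> n; apply: (continuous_series_n (u := fun k y => defect_term y k)) => k.
apply: (@continuous_near_eq _ _ (fun y => harmonic_defect (k.+1%:R / y))).
  near=> y; rewrite /defect_term ifT//; apply/andP; split.
    by near: y; exact: lt_nbhsr.
  by near: y; exact: lt_nbhsl.
apply: (@continuous_comp_fun _ (fun y => k.+1%:R / y) (@harmonic_defect R)).
  by apply: cvgM; [exact: cvg_cst|apply: cvgV; [rewrite gt_eqF|exact: cvg_id]].
apply: continuous_harmonic_defect; last by rewrite divr_gt0.
exact/irrational_mulSn/irrational_inv.
Unshelve. all: by end_near. Qed.

Lemma continuous_gauss_alpha (R : realType) (k : nat) (x : R) :
  irrational x -> {for x, continuous (@gauss_alpha R k)}.
Proof.
move=> ix; elim: k => [|k IH]; first exact: cvg_id.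
apply: (@continuous_comp_fun _ (@gauss_alpha R k) (@gauss R)); first exact: IH.
have ia := gauss_alpha_irrational (k := k) ix.
apply: (@continuous_comp_fun _ GRing.inv (@fracpart R)).
  by apply: cvgV; [exact: irrational_neq0|exact: cvg_id].
exact/continuous_fracpart/irrational_inv.
Qed.

Lemma continuous_gauss_betap (R : realType) (k : nat) (x : R) :
  irrational x -> {for x, continuous (@gauss_betap R k)}.
Proof.
move=> ix; elim: k => [|k IH].
  have -> : @gauss_betap R 0 = cst 1.
    by apply/funext => y; rewrite /gauss_betap big_ord0.
  exact: cvg_cst.
have -> : @gauss_betap R k.+1 = (fun y => gauss_betap k y * gauss_alpha k y).
  by apply/funext => y; rewrite gauss_betapS.
by apply: cvgM; [exact: IH|exact: continuous_gauss_alpha].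
Qed.

Lemma continuous_wilton_defect (R : realType) (x : R) :
  irrational x -> {for x, continuous (@wilton_defect R)}.
Proof.
move=> ix; have fr01 (y : R) : 0 <= fracpart y < 1.
  by rewrite fracpart_ge0 fracpart_lt1.
apply: (@continuous_dist_le _
  (fun n y => series (wilton_defect_term (fracpart y)) n) _
  (fun n => 8 * recip_bound R * (3 / 4) ^+ n)).
- by move=> n y; exact: dist_wilton_defect.
- by apply: cvg_geometric; rewrite ger0_norm; lra.
move=> n.
apply: (continuous_series_n
  (u := fun k y => wilton_defect_term (fracpart y) k)) => k.
apply: (@continuous_comp_fun _ (@fracpart R) (fun y => wilton_defect_term y k)).
  exact: continuous_fracpart.
have iy := irrational_fracpart ix.
apply: cvgM; first apply: cvgM.
- exact: cvg_cst.
- exact: continuous_gauss_betap.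
apply: (@continuous_comp_fun _ (@gauss_alpha R k) (@recip_defect R)).
  exact: continuous_gauss_alpha.
apply: continuous_recip_defect; first exact: gauss_alpha_irrational.
have /andP[_ ->] := gauss_alpha_itv k (fr01 x).
by rewrite gauss_alpha_gt0.
Qed.

Theorem proposition2 (R : realType) :
  exists G : R -> R,
    [/\ periodic G 1,
        bounded_fun G,
        (forall x : R, irrational x -> {for x, continuous G}) &
        {ae (@lebesgue_measure R), forall x : R,
          [/\ cvgn (series (phi1_term x)),
              cvgn (series (wilton_term x)) &
              phi1 x = - 2^-1 * wilton x + G x]}].
Proof.
exists (@wilton_defect R); split.
- by move=> x; rewrite /wilton_defect fracpartD_int// int_num1.
- exists (8 * recip_bound R); split; first exact: num_real.
  move=> B hB x _; apply: le_trans (ltW hB).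
  have fr01 : 0 <= fracpart x < 1 by rewrite fracpart_ge0 fracpart_lt1.
  have := dist_wilton_defect 0 fr01.
  by rewrite /series /= big_geq// sub0r normrN expr0 mulr1.
- exact: continuous_wilton_defect.
have aeF := ae_filter_ringOfSetsType (@lebesgue_measure R).
apply: filterS (@ae_wilton_cvg R) => x [ix cw].
have cphi := phi1_wilton_pointwise ix cw.
by split => //; [apply/cvg_ex; eexists; exact: cphi|exact: cvg_lim cphi].
Qed.
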